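(* Let $q$ be a positive integer and let $H$ be a skew type Hadamard matrix of order $q+1$ of the form $H=\begin{pmatrix}1&\mathbf 1^\top\\-\mathbf 1& I_q+Q\end{pmatrix}$, where $\mathbf 1$ is the all-ones column vector of length $q$ and $Q$ is a $q\times q$ matrix. Let $C=H-I_{q+1}$ and define the $q(q+1)\times q(q+1)$ matrix $M=-I_{q+1}\otimes J_q+C\otimes (I_q+Q)$. Then $M$ is a balancedly splittable Hadamard matrix of order $q(q+1)$ with parameters $(q(q+1),q,q,-1)$.
   Context: A Hadamard matrix of order $n$ is an $n\times n$ $\{1,-1\}$-matrix $H$ with $HH^\top=nI_n$; it is of skew type if $H+H^\top=2I_n$. $J_n$ is the all-ones matrix and $\otimes$ is the Kronecker product. A Hadamard matrix of order $n$ is balancedly splittable with parameters $(n,\ell,a,b)$ if, after permuting its rows, $H=\begin{pmatrix}H_1\\H_2\end{pmatrix}$ with $H_1$ an $\ell\times n$ matrix such that $H_1^\top H_1=\ell I_n+aA+b(J_n-A-I_n)$ for a symmetric $(0,1)$-matrix $A$ with zero diagonal. *)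

(* Defs.v *)
From mathcomp Require Import all_boot all_order fingroup perm all_algebra.
From mathcomp Require Import mxtens.

Set Implicit Arguments.
Unset Strict Implicit.
Unset Printing Implicit Defensive.

Import GRing.Theory.
Local Open Scope ring_scope.

Definition hadamard (n : nat) (H : 'M[int]_n) : Prop :=
  (forall i j, H i j = 1 \/ H i j = -1) /\ H *m H^T = (n%:R)%:M.

Definition skew_type_hadamard (n : nat) (H : 'M[int]_n) : Prop :=
  hadamard H /\ H + H^T = (2%:R)%:M.

Definition all_ones (m n : nat) : 'M[int]_(m, n) := const_mx 1.

Definition zero_one_mx (n : nat) (A : 'M[int]_n) : Prop :=
  forall i j, A i j = 0 \/ A i j = 1.

(* The cast identifies the row indices 'I_(l + k) of the stacked matrix
   with 'I_n. *)
Definition balancedly_splittable_hadamard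
    (n l : nat) (a b : int) (H : 'M[int]_n) : Prop :=
  hadamard H /\
  exists (k : nat) (e : (l + k)%N = n) (s : 'S_n)
         (H1 : 'M[int]_(l, n)) (H2 : 'M[int]_(k, n)),
    row_perm s H = castmx (e, erefl n) (col_mx H1 H2) /\
    exists A : 'M[int]_n,
      [/\ zero_one_mx A, A^T = A, (forall i, A i i = 0)
        & H1^T *m H1 = (l%:R)%:M + a *: A + b *: (all_ones n n - A - 1%:M)].
Arguments balancedly_splittable_hadamard : clear implicits.

(* Main.v *)
Require Import Defs.
From mathcomp Require Import all_boot all_order fingroup perm all_algebra.
From mathcomp Require Import mxtens ring.

(** The core [K = 1 + Q] satisfies [K J = J = K^T J] and
    [K K^T = K^T K = (q + 1) I - J], while [C] is skew with [C C^T = q I].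
    In [M M^T] the mixed terms add up to [(C + C^T) (x) J = 0] and the others
    to [q I (x) J + q I (x) ((q + 1) I - J) = q (q + 1) I].  The first block of
    rows is [(-J, K, ..., K)], whose Gram matrix has the blocks [q J], [-J] and
    [(q + 1) I - J], hence off-diagonal entries [q] and [-1] only. *)

Import GRing.Theory.

Local Open Scope ring_scope.

(** The witness [A] marks the off-diagonal positions where the Gram matrix takes the value [a]; it
    is symmetric because a Gram matrix is. The rows are already stacked, so the identity permutation
    serves. *)
Lemma balancedly_splittable_of_gram (l k : nat) (a b : int)
    (M : 'M[int]_(l + k)) :
  hadamard M ->
  (forall i, ((usubmx M)^T *m usubmx M) i i = l%:R) ->
  (forall i j, i != j -> ((usubmx M)^T *m usubmx M) i j = a \/
                         ((usubmx M)^T *m usubmx M) i j = b) ->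
  balancedly_splittable_hadamard (l + k) l a b M.
Proof.
move=> hM; set G := _ *m _ => Gdiag Goff; split=> //.
exists k, erefl, 1%g, (usubmx M), (dsubmx M).
split; first by rewrite row_perm1 castmx_id vsubmxK.
have Gsym i j : G j i = G i j.
  by have /matrixP/(_ i j) : G^T = G by [rewrite trmx_mul trmxK]; rewrite mxE.
rewrite -/G; move: G Gdiag Goff Gsym => G Gdiag Goff Gsym.
exists (\matrix_(i, j) ((i != j) && (G i j == a))%:R); split.
- by move=> i j; rewrite mxE; case: (_ && _); [right | left].
- by apply/matrixP=> i j; rewrite !mxE eq_sym Gsym.
- by move=> i; rewrite mxE eqxx.
apply/matrixP=> i j; rewrite !mxE.
have [->|neq_ij] := eqVneq i j; first by rewrite Gdiag /=; ring.
by case: eqP => [->|neq_a] /=; [|case: (Goff i j neq_ij) => // ->]; ring.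
Qed.

Lemma sum_sign_sqr (n : nat) (v : 'I_n -> int) :
  (forall i, v i = 1 \/ v i = -1) -> \sum_i v i * v i = n%:R.
Proof.
move=> vP; under eq_bigr => i _.
  rewrite (_ : v i * v i = 1); last by case: (vP i) => ->.
  over.
by rewrite sumr_const card_ord.
Qed.

(** Everything is read off blockwise: the lower left block of [H *m H^T] gives the row sums of [K],
    its lower right block gives [J + K *m K^T], and the lower right block of [H + H^T] gives
    [K + K^T]. *)
Lemma skew_hadamard_core (q : nat) (Q : 'M[int]_q) :
  skew_type_hadamard (block_mx (1%:M : 'M[int]_1) (all_ones 1 q)
                               (- all_ones q 1) (1%:M + Q)) ->
  let K := 1%:M + Q in
  [/\ forall i j, K i j = 1 \/ K i j = -1,
      K + K^T = 2%:R%:M,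
      K *m all_ones q 1 = all_ones q 1
    & K *m K^T = (1 + q)%:R%:M - all_ones q q].
Proof.
set H := block_mx _ _ _ _ => -[[sgnH HHT] skewH] K.
move: HHT skewH; rewrite /H tr_block_mx mulmx_block add_block_mx !scalar_mx_block.
move=> /eq_block_mx[_ _ rowK gramK] /eq_block_mx[_ _ _ skewK]; split=> //.
- by move=> i j; move: (sgnH (rshift 1 i) (rshift 1 j)); rewrite block_mxEdr.
- apply/eqP; rewrite -subr_eq0 addrC -rowK trmx1 mulmx1.
  by rewrite /all_ones trmx_const.
- rewrite -gramK /all_ones linearN /= trmx_const mulNmx mulmxN opprK.
  suff -> : const_mx 1 *m (const_mx 1 : 'rV_q) = const_mx 1 :> 'M[int]_q by rewrite addrAC subrr add0r.
  by apply/matrixP=> i j; rewrite !mxE big_ord1 !mxE mulr1.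
Qed.

Lemma mul_all_ones_of_row_sum (q : nat) (K : 'M[int]_q) (n : nat) :
  K *m all_ones q 1 = all_ones q 1 -> K *m all_ones q n = all_ones q n.
Proof.
move=> /matrixP rowK; apply/matrixP=> i j; have := rowK i ord0.
by rewrite !mxE => <-; apply: eq_bigr => k _; rewrite !mxE.
Qed.

(** The entries are signs because [C] vanishes exactly on the diagonal, so the two Kronecker terms
    have complementary supports. *)
Lemma hadamard_tens_core (q : nat) (C : 'M[int]_(1 + q)) (K : 'M[int]_q) :
  (forall i j, C i j = (i != j)%:R \/ C i j = - (i != j)%:R) ->
  C + C^T = 0 -> C *m C^T = q%:R%:M ->
  (forall i j, K i j = 1 \/ K i j = -1) ->
  K *m all_ones q 1 = all_ones q 1 ->
  K *m K^T = (1 + q)%:R%:M - all_ones q q ->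
  hadamard (- (1%:M *t all_ones q q) + C *t K).
Proof.
move=> sgnC skewC gramC sgnK rowK gramK; split.
  move=> r s; case: (mxtens_indexP r) => i j; case: (mxtens_indexP s) => k l.
  rewrite !(mxE, tensmxE, mxtens_indexK) /=.
  have [<-|neq_ik] := eqVneq i k.
    right; have := sgnC i i; rewrite eqxx oppr0 => -[] ->;
      by rewrite mul0r addr0 mulr1.
  have := sgnC i k; rewrite neq_ik.
  by case=> ->; case: (sgnK j l) => ->; [left|right|right|left].
rewrite linearD linearN /= !trmx_tens trmx1 /all_ones trmx_const.
have KJ := mul_all_ones_of_row_sum _ _ q rowK.
have JKT : all_ones q q *m K^T = all_ones q q.
  by rewrite -[LHS]trmxK trmx_mul trmxK {1}/all_ones trmx_const KJ trmx_const.
have JJ : all_ones q q *m all_ones q q = q%:R *: all_ones q q.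
  apply/matrixP=> i j; rewrite !mxE mulr1.
  by under eq_bigr => k _ do rewrite !mxE mulr1; rewrite sumr_const card_ord.
rewrite mulmxDl !mulmxDr !mulNmx !mulmxN !tensmx_mul opprK mul1mx !mulmx1.
rewrite -/(all_ones q q) JJ JKT KJ gramC gramK mul1mx.
have {}skewC i k : C k i = - C i k.
  apply/eqP; rewrite -addr_eq0 addrC.
  by have /matrixP/(_ i k) := skewC; rewrite !mxE => ->.
apply/matrixP=> r s; case: (mxtens_indexP r) => i j; case: (mxtens_indexP s) => k l.
rewrite !(mxE, tensmxE, mxtens_indexK) /= (can_eq (@mxtens_indexK _ _)) xpair_eqE.
rewrite skewC natrM.
by case: (i == k); case: (j == l) => /=; ring.
Qed.

Theorem theorem3p8 (q : nat) (q_gt0 : (0 < q)%N)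
    (H : 'M[int]_(1 + q)) (Q : 'M[int]_q)
    (skewH : skew_type_hadamard H)
    (formH : H = block_mx (1%:M : 'M[int]_1) (all_ones 1 q)
                          (- all_ones q 1) (1%:M + Q)) :
  let C := H - 1%:M in
  let M := - ((1%:M : 'M[int]_(1 + q)) *t all_ones q q) + C *t (1%:M + Q) in
  balancedly_splittable_hadamard ((1 + q) * q)%N q q%:Z (-1) M.
Proof.
move=> C; set K := 1%:M + Q => M.
have [[sgnH HHT] HDHT] := skewH.
have := skewH; rewrite formH => /skew_hadamard_core[sgnK KDKT rowK gramK].
rewrite -/K in sgnK KDKT rowK gramK.
have Hdiag i : H i i = 1.
  have /matrixP/(_ i i) := HDHT; rewrite !mxE eqxx.
  by case: (sgnH i i) => ->.
have sgnC i j : C i j = (i != j)%:R \/ C i j = - (i != j)%:R.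
  rewrite !mxE; have [<-|_] := eqVneq i j; first by left; rewrite Hdiag.
  by rewrite subr0; apply: sgnH.
have skewC : C + C^T = 0.
  rewrite /C linearB /= trmx1 addrACA HDHT; apply/matrixP=> i j; rewrite !mxE; ring.
(* Expanding gives [H *m H^T - (H + H^T) + 1], that is [(1 + q) - 2 + 1 = q] times the identity. *)
have gramC : C *m C^T = q%:R%:M.
  rewrite /C linearB /= trmx1 mulmxBl !mulmxBr HHT mulmx1 !mul1mx.
  have -> : H^T = 2%:R%:M - H by rewrite -HDHT addrAC subrr add0r.
  by apply/matrixP=> i j; rewrite !mxE; ring.
have C0 c : C ord0 c = (c != ord0)%:R.
  rewrite /C !mxE; have -> : ord0 = lshift q ord0 :> 'I_(1 + q) by apply: val_inj.
  rewrite formH; case: (split_ordP c) => j ->.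
    by rewrite block_mxEul (ord1 j) mxE eqxx.
  by rewrite block_mxEur mxE eq_lrshift eq_rlshift subr0.
have hM : hadamard M by apply: hadamard_tens_core.
(* As a polynomial in [K], [K^T] commutes with [K]; this carries the row sums and the row Gram
   matrix of [K] over to its columns. *)
have KTE : K^T = 2%:R%:M - K by rewrite -KDKT addrAC subrr add0r.
have colK d : \sum_i K i d = 1.
  have /matrixP/(_ d ord0) : K^T *m all_ones q 1 = all_ones q 1.
    rewrite KTE mulmxBl rowK mul_scalar_mx; apply/matrixP=> i j; rewrite !mxE; ring.
  by rewrite !mxE => <-; apply: eq_bigr => i _; rewrite !mxE mulr1.
have gramKT d d' : \sum_i K i d * K i d' = (1 + q)%:R *+ (d == d') - 1.
  have /matrixP/(_ d d') : K^T *m K = (1 + q)%:R%:M - all_ones q q.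
    by rewrite -gramK KTE mulmxBl mulmxBr scalar_mxC.
  by rewrite !mxE => <-; apply: eq_bigr => i _; rewrite !mxE.
(* The dimension [(1 + q) * q] computes to [q + q * q], and the top [q] rows are those with
   Kronecker block index [ord0]. *)
have Mtop i c d : usubmx (M : 'M_(q + q * q, _)) i (mxtens_index (c, d)) =
    - (c == ord0)%:R + (c != ord0)%:R * K i d.
  rewrite mxE; have -> : lshift (q * q) i = mxtens_index (ord0 : 'I_(1 + q), i).
    exact: val_inj.
  by rewrite !(mxE, tensmxE, mxtens_indexK) /= -C0 !mxE mulr1 eq_sym.
apply: (balancedly_splittable_of_gram q (q * q)) => //.
  move=> r; rewrite mxE; under eq_bigr => i _ do rewrite mxE.
  by apply: sum_sign_sqr => i; rewrite mxE; apply: hM.1.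
move=> r s; rewrite mxE; under eq_bigr => i _ do rewrite mxE.
move=> _; case: (@mxtens_indexP (1 + q) q r) => c d.
case: (@mxtens_indexP (1 + q) q s) => c' d'.
under eq_bigr => i _ do rewrite !Mtop.
(* Two columns of the block [-J] give [q]; one such column against a column of [K] gives minus a
   column sum, [-1]. *)
have [_|_] := eqVneq c ord0; have [_|_] := eqVneq c' ord0.
- left; under eq_bigr => i _ do rewrite !mul0r !addr0 mulrNN mulr1.
  by rewrite sumr_const card_ord natz.
- right; under eq_bigr => i _ do rewrite mul0r addr0 oppr0 add0r mul1r mulN1r.
  by rewrite sumrN colK.
- right; under eq_bigr => i _ do rewrite mul0r addr0 oppr0 add0r mul1r mulrN1.
  by rewrite sumrN colK.
(* Two columns from copies of [K] give an entry of [K^T *m K], which is [q] or [-1] according to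
   whether [d] equals [d']. *)
under eq_bigr => i _ do rewrite oppr0 !add0r !mul1r.
rewrite gramKT; case: (d == d'); [left | by right].
by rewrite mulr1n natrD addrAC subrr add0r natz.
Qed.
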